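(* Let $S$ be a left I-order in a Brandt semigroup $\mathcal{B}^0=\mathcal{B}^0(G,I)$. Then $S$ contains a zero and is straight in $\mathcal{B}^0$. If $\phi:S\to T$ is an isomorphism where $T$ is a left I-order in a Brandt semigroup $\mathcal{B}^0_1=\mathcal{B}^0(H,J)$, then $\phi$ lifts to an isomorphism $\overline{\phi}:\mathcal{B}^0\to\mathcal{B}^0_1$.
   Context: For a group $G$ and a non-empty set $I$, the Brandt semigroup $\mathcal{B}^0(G,I)$ is $(I\times G\times I)\cup\{0\}$ with $0$ a zero element and $(i,g,j)(k,h,l)=(i,gh,l)$ if $j=k$ and $0$ otherwise; it is an inverse semigroup with $(i,g,j)^{-1}=(j,g^{-1},i)$ and $0^{-1}=0$. A subsemigroup $S$ of an inverse semigroup $Q$ is a left I-order in $Q$ if every $q\in Q$ can be written as $q=a^{-1}b$ with $a,b\in S$ (where $a^{-1}$ is the inverse of $a$ in $Q$ in the sense of inverse semigroup theory); it is straight in $Q$ if every $q\in Q$ can be written as $q=a^{-1}b$ with $a,b\in S$ and $a\,\mathcal{R}\,b$ in $Q$ (Green's relation). That $\phi$ lifts to $\overline\phi$ means that $\overline\phi|_S=\phi$. *)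

(* Defs.v *)
From HB Require Import structures.
From mathcomp Require Import all_boot classical_sets.
Set Implicit Arguments.
Unset Strict Implicit.
Unset Printing Implicit Defensive.
Local Open Scope group_scope.
Local Open Scope classical_set_scope.

HB.mixin Record Semigroup_isInverse Q of Semigroup Q := {
  sinv : Q -> Q;
  mulKsinv : forall a : Q, a * sinv a * a = a;
  sinvKmul : forall a : Q, sinv a * a * sinv a = sinv a;
  sinv_uniq : forall a b : Q, a * b * a = a -> b * a * b = b -> b = sinv a
}.

#[short(type="inverseSemigroupType")]
HB.structure Definition InverseSemigroup :=
  {Q of Semigroup_isInverse Q & Semigroup Q}.

Record subsemigroup (Q : semigroupType) := Subsemigroup {
  carrier : set Q;
  carrierM : forall a b : Q, carrier a -> carrier b -> carrier (a * b)
}.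

Definition subsemigroup_type (Q : semigroupType) (S : subsemigroup Q) : Type :=
  {x : Q | x \in carrier S}.

Coercion subsemigroup_type : subsemigroup >-> Sortclass.

Section SubsemigroupType.
Context (Q : semigroupType) (S : subsemigroup Q).

Lemma carrier_mulg_closed : mulg_closed [in carrier S].
Proof.
by move=> a b /set_mem Sa /set_mem Sb; apply/mem_set/carrierM.
Qed.

HB.instance Definition _ := SubChoice.copy (subsemigroup_type S)
  {x : Q | x \in carrier S}.
HB.instance Definition _ := SubChoice_isSubSemigroup.Build Q
  (fun x => x \in carrier S) (subsemigroup_type S) carrier_mulg_closed.

End SubsemigroupType.

(* [a Q^1], where [Q^1] is [Q] with an identity adjoined if necessary. *)
Definition principal_right_ideal (Q : semigroupType) (a : Q) : set Q :=
  [set x | x = a \/ exists q : Q, x = a * q].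

Definition green_R (Q : semigroupType) (a b : Q) : Prop :=
  principal_right_ideal a = principal_right_ideal b.

Definition left_I_order (Q : inverseSemigroupType) (S : subsemigroup Q) : Prop :=
  forall q : Q, exists a b : S, q = sinv (val a) * val b.

Definition straight (Q : inverseSemigroupType) (S : subsemigroup Q) : Prop :=
  forall q : Q, exists a b : S,
    q = sinv (val a) * val b /\ green_R (val a) (val b).

(* [None] is the zero, [Some (i, g, j)] the triple [(i, g, j)]. *)
Definition brandt (G I : Type) : Type := option (I * G * I).

Definition brandt0 (G I : Type) : brandt G I := None.

HB.instance Definition _ (G I : choiceType) :=
  Choice.copy (brandt G I) (option (I * G * I)).

Section BrandtSemigroup.
Context (G : groupType) (I : choiceType).
Implicit Types x y : brandt G I.

Definition brandt_mul x y : brandt G I :=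
  match x, y with
  | Some (i, g, j), Some (k, h, l) =>
      if j == k then Some (i, g * h, l) else brandt0 G I
  | _, _ => brandt0 G I
  end.

Lemma brandt_mulA : associative brandt_mul.
Proof.
case=> [[[i g] j]|] [[[k h] l]|] [[[m f] n]|] //=; last by case: ifP.
by case lm: (l == m); case jk: (j == k); rewrite //= ?jk ?lm ?mulgA.
Qed.

HB.instance Definition _ := isSemigroup.Build (brandt G I) brandt_mulA.

Definition brandt_inv x : brandt G I :=
  if x is Some (i, g, j) then Some (j, g^-1, i) else brandt0 G I.

Lemma brandt_mulKinv x : x * brandt_inv x * x = x.
Proof.
case: x => [[[i g] j]|] //; rewrite /mul /= eqxx /=.
by rewrite !eqxx /= mulgV mul1g.
Qed.

Lemma brandt_invKmul x : brandt_inv x * x * brandt_inv x = brandt_inv x.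
Proof.
case: x => [[[i g] j]|] //; rewrite /mul /= eqxx /=.
by rewrite !eqxx /= mulVg mul1g.
Qed.

Lemma brandt_inv_uniq x y : x * y * x = x -> y * x * y = y -> y = brandt_inv x.
Proof.
case: x y => [[[i g] j]|] [[[k h] l]|] //; rewrite /mul /=.
case: (j =P k) => [<-|//] /=; case: (l =P i) => [->|//] [E] _.
congr (Some (_, _, _)); apply: (mulgI g); apply: (mulIg g).
by rewrite E mulgV mul1g.
Qed.

HB.instance Definition _ := Semigroup_isInverse.Build (brandt G I)
  brandt_mulKinv brandt_invKmul brandt_inv_uniq.

End BrandtSemigroup.

(* Main.v *)
Require Import Defs.
From HB Require Import structures.
From mathcomp Require Import all_boot classical_sets.
From mathcomp Require Import boolp.
Set Implicit Arguments.
Unset Strict Implicit.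
Unset Printing Implicit Defensive.

(** A left I-order [S] in a Brandt semigroup is recovered from its
    multiplication: everything one needs to know about the fractions
    [a^-1 b] can be phrased inside [S], using only products and the zero.

    In a Brandt semigroup a product either vanishes or allows cancellation,
    [x^-1 (x y) = y] and [(x y) y^-1 = x].  Hence a nonzero fraction [a^-1 b]
    has [a] and [b] in the same R-class ([green_R_of_fraction]), which gives
    straightness once zero is known to lie in [S]; the latter holds because
    writing zero as [a^-1 b] forces one of [a], [b], [a b], [a a] to
    vanish ([order_has_zero]).

    For the lifting, two facts about the fractions are internal to [S]:
    - [a^-1 b] is nonzero exactly when some [x] in [S] has [x a] and [x b]
      nonzero ([fraction_neq0P]);
    - [b c^-1] equals a nonzero fraction [x^-1 y] exactly when [x b = y c] is
      nonzero ([sinv_mul_eqP]), and as [b c^-1] always is some fraction, it is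
      nonzero exactly when [b] and [c] have a nonzero common left multiple
      ([common_multipleP]), as in Ore's theorem.
    Through the second fact, equality and multiplication of fractions reduce
    to common left multiples.  So if one semigroup [U] is embedded by [f] and
    [g] as a left I-order in two Brandt semigroups, then
    [(f a)^-1 (f b) |-> (g a)^-1 (g b)] is a well-defined homomorphism
    ([fraction_transfer], [fraction_map]).  Exchanging [f] and [g] gives its
    inverse.  The theorem is the case where [U] is [S], [f] is the inclusion
    and [g] is [phi] followed by the inclusion of [T]; treating the two
    embeddings symmetrically avoids any separate study of the inverse of
    [phi]. *)

Local Open Scope group_scope.

(** * Cancellation in Brandt semigroups *)

Section BrandtTheory.
Context (G : groupType) (I : choiceType).
Implicit Types x y z a b c d : brandt G I.
Local Notation "0" := (brandt0 G I).

Lemma mul0b x : 0 * x = 0. Proof. by []. Qed.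

Lemma mulb0 x : x * 0 = 0. Proof. by case: x => [[[i g] j]|]. Qed.

Lemma mulb_Some i j k l (g h : G) :
  (Some (i, g, j) : brandt G I) * Some (k, h, l) =
  if j == k then Some (i, g * h, l) else 0.
Proof. by []. Qed.

Lemma sinv_Some i j (g : G) :
  sinv (Some (i, g, j) : brandt G I) = Some (j, g^-1, i).
Proof. by []. Qed.

Lemma sinvbK x : sinv (sinv x) = x.
Proof. by case: x => [[[i g] j]|] //; rewrite !sinv_Some invgK. Qed.

Lemma sinvbM x y : sinv (x * y) = sinv y * sinv x.
Proof.
case: x y => [[[i g] j]|] [[[k h] l]|] //.
rewrite !sinv_Some !mulb_Some eq_sym.
by case: eqP => // _; rewrite sinv_Some invgM.
Qed.

Lemma mulb_neq0l x y : x * y != 0 -> x != 0.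
Proof. by apply: contraNneq => ->. Qed.

Lemma mulb_neq0r x y : x * y != 0 -> y != 0.
Proof. by apply: contraNneq => ->; rewrite mulb0. Qed.

Lemma mulb_neq0E i j (g : G) x : (Some (i, g, j) : brandt G I) * x != 0 ->
  exists h l, x = Some (j, h, l).
Proof.
case: x => [[[k h] l]|]; last by rewrite mulb0.
by rewrite mulb_Some; case: (j =P k) => [<-|//] _; exists h, l.
Qed.

Lemma mulVKb x y : x * y != 0 -> sinv x * (x * y) = y.
Proof.
case: x => [[[i g] j]|] // /mulb_neq0E[h [l ->]].
by rewrite sinv_Some !(mulb_Some, eqxx) mulgA mulVg mul1g.
Qed.

Lemma mulbVK x y : sinv x * y != 0 -> x * (sinv x * y) = y.
Proof. by move/mulVKb; rewrite sinvbK. Qed.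

Lemma mulbKV x y : x * y != 0 -> x * y * sinv y = x.
Proof.
case: x => [[[i g] j]|] // /mulb_neq0E[h [l ->]].
by rewrite sinv_Some !(mulb_Some, eqxx) -mulgA mulgV mulg1.
Qed.

Lemma mulbV_neq0 x : x != 0 -> x * sinv x != 0.
Proof. by case: x => [[[i g] j]|] // _; rewrite sinv_Some mulb_Some eqxx. Qed.

Lemma mulb_neq0 x y z : x * y != 0 -> y * z != 0 -> x * y * z != 0.
Proof.
case: x => [[[i g] j]|] // /mulb_neq0E[h [l ->]] /mulb_neq0E[h' [l' ->]].
by rewrite !(mulb_Some, eqxx).
Qed.

Lemma fraction_neq0 x a b : x * a != 0 -> x * b != 0 -> sinv a * b != 0.
Proof.
case: x => [[[i g] j]|] // /mulb_neq0E[h [l ->]] /mulb_neq0E[h' [l' ->]].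
by rewrite sinv_Some !(mulb_Some, eqxx).
Qed.

(** Expanding a fraction by [x] changes nothing as soon as the denominator
    survives: [a^-1 x^-1 x = (x^-1 x a)^-1 = a^-1]. *)
Lemma fraction_expand x a b : x * a != 0 ->
  sinv (x * a) * (x * b) = sinv a * b.
Proof.
move=> xa; rewrite mulgA; congr (_ * b).
by rewrite -[X in _ * X]sinvbK -sinvbM mulVKb.
Qed.

(** Cross-multiplication: multiply [b c^-1 = x^-1 y] by [x] on the left and by
    [c] on the right.  The nonvanishing conditions make the cancellations
    legitimate, and have to be carried along in both directions. *)
Lemma sinv_mul_eqP x y b c :
  (b * sinv c = sinv x * y /\ b * sinv c != 0) <->
  (x * b = y * c /\ x * b != 0).
Proof.
split=> -[e nz].
  have xbc : x * b * sinv c = y by rewrite -mulgA e mulbVK // -e.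
  have y0 : y != 0 by move: nz; rewrite e; apply: mulb_neq0r.
  split; last by apply: mulb_neq0l (sinv c) _; rewrite xbc.
  by rewrite -{1}xbc -{2}[c]sinvbK mulbKV // xbc.
have bc : b * sinv c = sinv x * y.
  by rewrite -{1}(mulVKb nz) e -mulgA mulbKV // -e.
split=> //; apply: (@mulb_neq0l _ c).
by rewrite bc -mulgA -e mulVKb //; apply: mulb_neq0r nz.
Qed.

Lemma fraction_neq0_sym a b : sinv a * b != 0 -> sinv b * a != 0.
Proof.
by apply: contraNneq => ba; rewrite -[b]sinvbK -sinvbM ba; apply: eqxx.
Qed.

(** Each of [a] and [b] is a right multiple of the other, by
    [a (a^-1 b) = b] and [b (b^-1 a) = a]. *)
Lemma green_R_of_fraction a b : sinv a * b != 0 -> green_R a b.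
Proof.
suff sub c d : sinv d * c != 0 ->
    (principal_right_ideal c `<=` principal_right_ideal d)%classic.
  move=> ab; apply/seteqP; split; apply: sub => //.
  exact: fraction_neq0_sym.
move=> dc x [->|[q ->]]; right; first by exists (sinv d * c); rewrite mulbVK.
by exists (sinv d * c * q); rewrite mulgA mulbVK.
Qed.

End BrandtTheory.

(** * Fractions over an embedded left I-order *)

Section Order.
Context (U : semigroupType) (G : groupType) (I : choiceType).
Context (f : {multiplicative U -> brandt G I}).
Hypothesis f_order : forall q, exists a b, q = sinv (f a) * f b.
Local Notation "0" := (brandt0 G I).

(** If [a = (i, g, j)] and [b = (k, h, l)] satisfy [a^-1 b = 0], then
    [i <> k]; were [a b] and [a a] both nonzero, then [j = k] and [j = i], a
    contradiction. *)
Lemma order_has_zero : exists z, f z = 0.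
Proof.
have [a [b]] := f_order 0.
case fa: (f a) => [[[i g] j]|]; last by exists a.
case fb: (f b) => [[[k h] l]|]; last by exists b.
rewrite sinv_Some mulb_Some; case: eqP => // ik _.
have [jk|/eqP jk] := eqVneq j k; last first.
  by exists (a * b); rewrite gmulfM fa fb mulb_Some; case: eqP jk.
exists (a * a); rewrite gmulfM fa mulb_Some.
by case: eqP => // ji; case: ik; rewrite -ji.
Qed.

(** The order property writes [b c^-1] itself as a fraction [x^-1 y], and
    cross-multiplying yields the multiple. *)
Lemma common_multipleP b c :
  f b * sinv (f c) != 0 <-> exists x y, f (x * b) = f (y * c) /\ f (x * b) != 0.
Proof.
split=> [nz|[x [y]]]; last first.
  by rewrite !gmulfM => /(sinv_mul_eqP (f x) (f y) (f b) (f c)).2[].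
have [x [y e]] := f_order (f b * sinv (f c)).
by exists x, y; rewrite !gmulfM; apply/sinv_mul_eqP.
Qed.

(** Whether a fraction vanishes is visible in the multiplication of [U]: a
    nonzero [a^-1 b] means that [a] and [b] share their first index [i], and
    [x] is any element of [U] whose last index is [i]. *)
Lemma fraction_neq0P a b :
  sinv (f a) * f b != 0 <-> exists x, f (x * a) != 0 /\ f (x * b) != 0.
Proof.
split=> [nz|[x]]; last by rewrite !gmulfM => -[]; apply: fraction_neq0.
have [sa0 b0] := (mulb_neq0l nz, mulb_neq0r nz).
have a0 : f a != 0 by apply: contraNneq sa0 => ->.
(* a common multiple of [a] with itself provides [x] with [x a] nonzero *)
have [x [_ [_]]] := (common_multipleP a a).1 (mulbV_neq0 a0).
rewrite gmulfM => xa; exists x; rewrite !gmulfM; split=> //.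
by rewrite -{1}(mulbVK nz) mulgA mulb_neq0 // mulbVK.
Qed.

End Order.

(** * Two embeddings of the same left I-order *)

Section Transfer.
Context (U : semigroupType) (G H : groupType) (I J : choiceType).
Context (f : {multiplicative U -> brandt G I}).
Context (g : {multiplicative U -> brandt H J}).
Hypothesis f_order : forall q, exists a b, q = sinv (f a) * f b.
Hypothesis g_order : forall q, exists a b, q = sinv (g a) * g b.
Hypotheses (f_inj : injective f) (g_inj : injective g).

(** Both embeddings send the zero of [U] to zero, since their images contain
    zero and [U] has only one zero element. *)
Lemma embedding_eq0 s : (f s == brandt0 G I) = (g s == brandt0 H J).
Proof.
have [z fz] := order_has_zero f_order; have [t gt] := order_has_zero g_order.
have zt : z = t.
  have <- : z * t = z by apply: f_inj; rewrite gmulfM fz.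
  by apply: g_inj; rewrite gmulfM gt mulb0.
by rewrite -fz -gt -zt (inj_eq f_inj) (inj_eq g_inj).
Qed.

Lemma fraction_eq0_transfer a b :
  (sinv (f a) * f b == brandt0 G I) = (sinv (g a) * g b == brandt0 H J).
Proof.
apply: negb_inj; apply/idP/idP.
  move/(fraction_neq0P f_order) => [x [xa xb]].
  by apply/(fraction_neq0P g_order); exists x; rewrite -!embedding_eq0.
move/(fraction_neq0P g_order) => [x [xa xb]].
by apply/(fraction_neq0P f_order); exists x; rewrite !embedding_eq0.
Qed.

Lemma fraction_transfer a b c d :
  sinv (f a) * f b = sinv (f c) * f d -> sinv (g a) * g b = sinv (g c) * g d.
Proof.
move=> e; have [z|nz] := eqVneq (sinv (f a) * f b) (brandt0 G I).
  have /eqP-> : sinv (g a) * g b == brandt0 H J.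
    by rewrite -fraction_eq0_transfer z.
  by apply/esym/eqP; rewrite -fraction_eq0_transfer -e z.
have nz' : sinv (f c) * f d != brandt0 G I by rewrite -e.
(* the two fractions start in the same index, so that [a] and [c] have a
   common left multiple; expand both fractions to this denominator *)
have ac : f a * sinv (f c) != brandt0 G I.
  apply: (@mulb_neq0l _ _ _ (f d)); rewrite -mulgA -e mulbVK //.
  exact: mulb_neq0r nz.
have [x [y [xy xa]]] := (common_multipleP f_order a c).1 ac.
have xbyd : x * b = y * d.
  apply: f_inj; rewrite !gmulfM -(mulbVK nz) e -{2}(mulbVK nz') !mulgA.
  by rewrite -!gmulfM xy.
have gxa : g x * g a != brandt0 H J by rewrite -gmulfM -embedding_eq0.
rewrite -(fraction_expand _ gxa) -!gmulfM xbyd (f_inj xy) !gmulfM.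
by rewrite fraction_expand // -gmulfM -(f_inj xy) gmulfM.
Qed.

(** Multiplicativity: with [x b = y c] nonzero, the product of [a^-1 b] and
    [c^-1 d] is [(x a)^-1 (y d)] in either Brandt semigroup, because
    [b c^-1 = x^-1 y] there; without such [x] and [y] it is zero in both. *)
Lemma fraction_map : exists h : {multiplicative brandt G I -> brandt H J},
  (forall a b, h (sinv (f a) * f b) = sinv (g a) * g b) /\
  (forall s, h (f s) = g s).
Proof.
have /choice[r rP] (q : brandt G I) :
    exists ab : U * U, q = sinv (f ab.1) * f ab.2.
  by have [a [b ->]] := f_order q; exists (a, b).
pose h q := sinv (g (r q).1) * g (r q).2.
have hE a b : h (sinv (f a) * f b) = sinv (g a) * g b.
  by apply: fraction_transfer; rewrite -rP.
have h0 : h (brandt0 G I) = brandt0 H J.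
  have [z fz] := order_has_zero f_order.
  have /eqP gz : g z == brandt0 H J by rewrite -embedding_eq0 fz.
  by have := hE z z; rewrite fz gz !mulb0.
have hM : {morph h : p q / p * q}.
  move=> p q; have [a [b ->]] := f_order p; have [c [d ->]] := f_order q.
  rewrite !hE !mulgA -![_ * f b * _]mulgA -![_ * g b * _]mulgA.
  have [fbc|fbc] := eqVneq (f b * sinv (f c)) (brandt0 G I).
    have -> : g b * sinv (g c) = brandt0 H J.
      apply/eqP; move/eqP: fbc; apply: contraTT.
      move/(common_multipleP g_order) => [x [y [/g_inj xy nz]]].
      apply/(common_multipleP f_order); exists x, y.
      by rewrite embedding_eq0 -xy.
    by rewrite fbc !mulb0 !mul0b h0.
  have [x [y [xy nz]]] := (common_multipleP f_order b c).1 fbc.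
  have gnz : g (x * b) != brandt0 H J by rewrite -embedding_eq0.
  have fE : f b * sinv (f c) = sinv (f x) * f y.
    by apply: (proj1 ((sinv_mul_eqP _ _ _ _).2 _)); rewrite -!gmulfM.
  have gE : g b * sinv (g c) = sinv (g x) * g y.
    apply: (proj1 ((sinv_mul_eqP _ _ _ _).2 _)).
    by rewrite -!gmulfM -(f_inj xy).
  rewrite fE gE !mulgA -!sinvbM -![_ * f y * _]mulgA -![_ * g y * _]mulgA.
  by rewrite -!gmulfM hE.
pose hB := isMultiplicative.Build _ _ h hM.
pose hh : {multiplicative _ -> _} := HB.pack h hB.
exists hh; split=> // s; change (h (f s) = g s).
have [fs|nz] := eqVneq (f s) (brandt0 G I).
  have /eqP gs : g s == brandt0 H J by rewrite -embedding_eq0 fs.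
  by rewrite gs fs h0.
have [a [b e]] := f_order (f s); rewrite e hE.
(* [a^-1 b = s] in the first Brandt semigroup means [b = a s] in [U] *)
have bE : b = a * s by apply: f_inj; rewrite gmulfM e mulbVK // -e.
rewrite bE gmulfM mulVKb // -gmulfM -bE -embedding_eq0.
by apply: (@mulb_neq0r _ _ (sinv (f a))); rewrite -e.
Qed.

End Transfer.


Theorem theorem2p11 (G : groupType) (I : choiceType) (I0 : inhabited I)
    (S : subsemigroup (brandt G I)) (S_order : left_I_order S) :
  (carrier S (brandt0 G I) /\ straight S) /\
  (forall (H : groupType) (J : choiceType) (J0 : inhabited J)
      (T : subsemigroup (brandt H J)) (T_order : left_I_order T)
      (phi : {multiplicative S -> T}),
    bijective phi ->
    exists phibar : {multiplicative brandt G I -> brandt H J},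
      bijective phibar /\ (forall s : S, phibar (val s) = val (phi s))).
Proof.
pose f : {multiplicative S -> brandt G I} := val.
have f_order q : exists a b, q = sinv (f a) * f b by apply: S_order.
have [z fz] := order_has_zero f_order.
split; first split.
- by rewrite -fz; apply: set_mem (valP z).
- move=> q; have [q0|nz] := eqVneq q (brandt0 G I).
    by exists z, z; split=> //; rewrite q0 [val z]fz.
  have [a [b e]] := S_order q; exists a, b; split=> //.
  by apply: green_R_of_fraction; rewrite -e.
move=> H J _ T T_order phi [psi phiK psiK].
pose g : {multiplicative S -> brandt H J} := val \o phi.
have g_order q : exists a b, q = sinv (g a) * g b.
  have [a [b e]] := T_order q.
  by exists (psi a), (psi b); rewrite /g /= !psiK.
have f_inj : injective f by apply: val_inj.
have g_inj : injective g by apply: inj_comp val_inj (can_inj phiK).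
have [h [hE hf]] := fraction_map f_order g_order f_inj g_inj.
have [k [kE _]] := fraction_map g_order f_order g_inj f_inj.
exists h; split=> //; exists k => q.
  by have [a [b ->]] := f_order q; rewrite hE kE.
by have [a [b ->]] := g_order q; rewrite kE hE.
Qed.
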